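(* Let $(M,e)$ and $(H,1)$ be two pointed manifolds, let $G$ be a Lie group with multiplication $m:G\times G\to G$, and let $i:M\hookrightarrow G$ and $j:H\hookrightarrow G$ be (injective) smooth maps sending $e$ and $1$, respectively, to the identity element of $G$. If $m\circ(i\times j):M\times H\to G$ is a diffeomorphism, then $G\cong M\,{}_\gamma\!\bowtie_\theta H$ as Lie groups, where the maps $\varphi:H\times M\to M$, $\psi:H\times M\to H$, $\phi:M\times M\to M$ (written $\phi(x,x')=x\cdot x'$), $\theta:M\times M\to H$, $\mu:H\times H\to H$ (written $\mu(h,h')=h\ast h'$), $\gamma:H\times H\to M$ are obtained from $$hx=\varphi(h,x)\,\psi(h,x),\qquad xx'=(x\cdot x')\,\theta(x,x'),\qquad hh'=\gamma(h,h')\,(h\ast h')$$ for any $x,x'\in M$ and any $h,h'\in H$ (products taken in $G$, with $M$ and $H$ identified with their images under $i$ and $j$).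
   Context: Bicocycle double cross product of manifolds: let $(M,e)$ and $(H,1)$ be pointed manifolds with smooth maps $\varphi:H\times M\to M$, $\psi:H\times M\to H$, $\phi:M\times M\to M$, $\phi(x,x')=:x\cdot x'$, $\theta:M\times M\to H$, $\mu:H\times H\to H$, $\mu(h,h')=:h\ast h'$, $\gamma:H\times H\to M$ satisfying $\varphi(1,x)=x$, $\varphi(h,e)=e$, $\psi(h,e)=h$, $\psi(1,x)=1$, $e\cdot e=e$, $1\ast1=1$, $\theta(e,e)=1$, $\gamma(1,1)=e$ for all $x\in M$, $h\in H$. If these maps are such that $M\times H$ is a Lie group with unit $(e,1)$ and multiplication $$(x,h)(x',h')=\Big(x\cdot[\varphi(h,x')\cdot\gamma(\psi(h,x'),h')],\ [\theta(x,\varphi(h,x'))\ast\psi(h,x')]\ast h'\Big),$$ then this Lie group is denoted $M\,{}_\gamma\!\bowtie_\theta H$ and is called the bicocycle double cross product of the manifolds $M$ and $H$.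
   Formalization: The isomorphism is proved under the added assumption that the displayed multiplication makes M×H a Lie group with unit (e,1), which can fail: for G=Z/8, M={0,1,4,5}, H={0,2} it is not associative; existence and smoothness of the six maps are proved without it. *)

(* Defs.v *)
From HB Require Import structures.
From mathcomp Require Import all_boot all_order all_algebra.
From mathcomp Require Import all_classical all_reals.
From mathcomp Require Import topology normedtype landau derive.

Set Implicit Arguments.
Unset Strict Implicit.
Unset Printing Implicit Defensive.

Import Order.TTheory GRing.Theory Num.Theory.
Import numFieldNormedType.Exports.

Local Open Scope classical_set_scope.
Local Open Scope ring_scope.

(* [f] is [k] times (Frechet) differentiable on the open set [U]. In finite
   dimension, [x |-> 'd f x] is differentiable iff all the directional
   derivatives [x |-> 'D_v f x] are; iterating the latter avoids iterated
   spaces of linear maps. *)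
Fixpoint differentiable_upto (R : realType) (m n k : nat)
    (U : set 'rV[R]_m) (f : 'rV[R]_m -> 'rV[R]_n) : Prop :=
  if k is k'.+1 then
    (forall x, U x -> differentiable f x) /\
    (forall v, differentiable_upto k' U (fun x => 'D_v f x))
  else True.

Definition smooth_on (R : realType) (m n : nat) (U : set 'rV[R]_m)
    (f : 'rV[R]_m -> 'rV[R]_n) : Prop :=
  forall k, differentiable_upto k U f.

Lemma near0_differentiable (R : realType) (V W : normedModType R)
    (h : V -> W) (x : V) :
  (\near x, h x = 0) -> differentiable h x.
Proof.
move=> h0.
have hx : h x = 0 by exact: (nbhs_singleton h0).
pose z : {linear V -> W} := \0.
have zc : continuous z by move=> y; exact: cst_continuous.
have hz : h \o shift x = cst (h x) + z +o_ 0 id.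
  apply/eqaddoP => e e0; near=> y.
  rewrite !fctE /= hx add0r oppr0 addr0.
  have -> : h (y + x) = 0.
    by near: y; have := h0; rewrite (near_shift 0) subr0.
  by rewrite normr0 mulr_ge0 // ltW.
apply/diff_locallyP; rewrite (diff_unique zc hz); split => //.
Unshelve. all: by end_near. Qed.

Lemma near_eq_differentiable (R : realType) (V W : normedModType R)
    (f g : V -> W) (x : V) :
  (\near x, f x = g x) -> differentiable f x -> differentiable g x.
Proof.
move=> fg df.
have dh : differentiable (g - f) x.
  apply: near0_differentiable.
  by apply: filterS fg => y e; rewrite !fctE e subrr.
have := differentiableD df dh.
by rewrite addrC subrK.
Qed.

Lemma differentiable_upto_eq (R : realType) (m n k : nat) (U : set 'rV[R]_m)
    (f g : 'rV[R]_m -> 'rV[R]_n) : open U -> (forall x, U x -> f x = g x) ->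
  differentiable_upto k U f -> differentiable_upto k U g.
Proof.
move=> oU; elim: k f g => [//|k IH] f g fg /= [df Df].
have near_fg x : U x -> \near x, f x = g x.
  move=> Ux; apply: filterS fg _.
  exact: open_nbhs_nbhs.
split=> [x Ux|v]; first exact: near_eq_differentiable (near_fg x Ux) (df x Ux).
by apply: IH (Df v) => x Ux; apply: near_eq_derive; exact: near_fg.
Qed.

Lemma differentiable_uptoD (R : realType) (m n k : nat) (U : set 'rV[R]_m)
    (f g : 'rV[R]_m -> 'rV[R]_n) : open U ->
  differentiable_upto k U f -> differentiable_upto k U g ->
  differentiable_upto k U (f + g).
Proof.
move=> oU; elim: k f g => [//|k IH] f g /= [df Df] [dg Dg].
split=> [x Ux|v]; first exact: differentiableD (df x Ux) (dg x Ux).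
apply: differentiable_upto_eq oU _ (IH _ _ (Df v) (Dg v)) => x Ux.
by rewrite deriveD //; apply: diff_derivable; [exact: df|exact: dg].
Qed.

Lemma differentiable_upto_linear (R : realType) (m1 m2 n1 n2 k : nat)
    (l : {linear 'rV[R]_m1 -> 'rV[R]_m2}) (L : {linear 'rV[R]_n1 -> 'rV[R]_n2})
    (U : set 'rV[R]_m2) (f : 'rV[R]_m2 -> 'rV[R]_n1) :
  continuous l -> continuous L -> open U ->
  differentiable_upto k U f ->
  differentiable_upto k (l @^-1` U) (fun x => L (f (l x))).
Proof.
move=> lC LC oU; have oV : open (l @^-1` U) by move/continuousP: lC; exact.
elim: k f => [//|k IH] f /= [df Df].
have dl x : differentiable l x by exact: linear_differentiable.
have dL x : differentiable L x by exact: linear_differentiable.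
have dfl x : U (l x) -> differentiable (f \o l) x.
  by move=> Ux; apply: differentiable_comp => //; exact: df.
have dLfl x : U (l x) -> differentiable (L \o (f \o l)) x.
  by move=> Ux; apply: differentiable_comp => //; exact: dfl.
split=> [x Ux|v]; first exact: dLfl.
apply: differentiable_upto_eq oV _ (IH _ (Df (l v))) => x Ux /=.
rewrite -/(L \o (f \o l)) (deriveE _ (dLfl x Ux)) (deriveE _ (df _ Ux)).
rewrite (diff_comp (dfl x Ux) (dL _)) (diff_lin _ LC) /=.
by rewrite (diff_comp (dl x) (df _ Ux)) (diff_lin _ lC).
Qed.

Lemma differentiable_upto_sub (R : realType) (m n k : nat)
    (U V : set 'rV[R]_m) (f : 'rV[R]_m -> 'rV[R]_n) :
  V `<=` U -> differentiable_upto k U f -> differentiable_upto k V f.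
Proof.
move=> VU; elim: k f => [//|k IH] f /= [df Df].
by split=> [x /VU /df //|v]; exact: IH (Df v).
Qed.

Lemma continuous_row_mx0 (R : realType) (n1 n2 : nat) :
  continuous (fun a : 'rV[R]_n1 => row_mx a (0 : 'rV[R]_n2)).
Proof.
move=> u A /nbhs_ballP[e /= e0 eA].
apply/nbhs_ballP; exists e => //= v [_ uv]; apply: eA; split => // i j.
case: (split_ordP j) => k ->; first by rewrite !row_mxEl; exact: uv.
by rewrite !row_mxEr; exact: ballxx.
Qed.

Lemma continuous_row_0mx (R : realType) (n1 n2 : nat) :
  continuous (fun b : 'rV[R]_n2 => row_mx (0 : 'rV[R]_n1) b).
Proof.
move=> u A /nbhs_ballP[e /= e0 eA].
apply/nbhs_ballP; exists e => //= v [_ uv]; apply: eA; split => // i j.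
case: (split_ordP j) => k ->; last by rewrite !row_mxEr; exact: uv.
by rewrite !row_mxEl; exact: ballxx.
Qed.

Lemma smooth_on_row_mx (R : realType) (m1 m2 n1 n2 : nat)
    (U : set 'rV[R]_m1) (V : set 'rV[R]_m2)
    (f : 'rV[R]_m1 -> 'rV[R]_n1) (g : 'rV[R]_m2 -> 'rV[R]_n2) :
  open U -> open V -> smooth_on U f -> smooth_on V g ->
  smooth_on [set y : 'rV[R]_(m1 + m2) | U (lsubmx y) /\ V (rsubmx y)]
    (fun y => row_mx (f (lsubmx y)) (g (rsubmx y))).
Proof.
move=> oU oV fU gV k.
pose L1 := mulmxr (row_mx (1%:M : 'M[R]_n1) (0 : 'M[R]_(n1, n2))) : 'rV_n1 -> _.
pose L2 := mulmxr (row_mx (0 : 'M[R]_(n2, n1)) (1%:M : 'M[R]_n2)) : 'rV_n2 -> _.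
have L1E : L1 = row_mx^~ 0.
  by apply/funext => a; rewrite /L1 /= mul_mx_row mulmx1 mulmx0.
have L2E : L2 = row_mx 0.
  by apply/funext => b; rewrite /L2 /= mul_mx_row mulmx1 mulmx0.
have L1c : continuous L1 by rewrite L1E; exact: continuous_row_mx0.
have L2c : continuous L2 by rewrite L2E; exact: continuous_row_0mx.
rewrite (_ : (fun y => _) = (fun y => L1 (f (lsubmx y))) +
    (fun y => L2 (g (rsubmx y)))); last first.
  by apply/funext => y; rewrite !fctE L1E L2E add_row_mx addr0 add0r.
have lc := @continuous_lsubmx R 1 m1 m2.
have rc := @continuous_rsubmx R 1 m1 m2.
apply: differentiable_uptoD.
- by apply: openI; [move/continuousP: lc|move/continuousP: rc]; exact.
- apply: (@differentiable_upto_sub _ _ _ _ (lsubmx @^-1` U)) => [y []//|].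
  exact: (@differentiable_upto_linear _ _ _ _ _ _ lsubmx L1 U f).
- apply: (@differentiable_upto_sub _ _ _ _ (rsubmx @^-1` V)) => [y []//|].
  exact: (@differentiable_upto_linear _ _ _ _ _ _ rsubmx L2 V g).
Qed.

(* A chart of dimension [n]; only the values of [chart_fun] on [chart_dom] and
   of [chart_inv] on the image of [chart_dom] are relevant. *)
Record chart (R : realType) (T : topologicalType) (n : nat) := Chart {
  chart_dom : set T;
  chart_fun : T -> 'rV[R]_n;
  chart_inv : 'rV[R]_n -> T;
  chart_dom_open : open chart_dom;
  chart_img_open : open (chart_fun @` chart_dom);
  chart_funK : forall x, chart_dom x -> chart_inv (chart_fun x) = x;
  chart_fun_continuous : forall x, chart_dom x -> {for x, continuous chart_fun};
  chart_inv_continuous : forall y, (chart_fun @` chart_dom) y ->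
    {for y, continuous chart_inv}
}.

Definition smooth_transition (R : realType) (T : topologicalType) (n : nat)
    (c d : chart R T n) : Prop :=
  smooth_on (chart_fun c @` (chart_dom c `&` chart_dom d))
    (chart_fun d \o chart_inv c).

(* The differential structure is presented by an atlas, not necessarily a
   maximal one. *)
Record manifold (R : realType) := Manifold {
  mfd_space :> topologicalType;
  mfd_dim : nat;
  mfd_hausdorff : hausdorff_space mfd_space;
  mfd_second_countable : @second_countable mfd_space;
  atlas : set (chart R mfd_space mfd_dim);
  atlas_cover : forall x, exists2 c, atlas c & chart_dom c x;
  atlas_smooth : forall c d, atlas c -> atlas d -> smooth_transition c d
}.

Definition smooth (R : realType) (M N : manifold R) (f : M -> N) : Prop :=
  continuous f /\
  forall (c : chart R M (mfd_dim M)) (d : chart R N (mfd_dim N)),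
    atlas c -> atlas d ->
    smooth_on (chart_fun c @` (chart_dom c `&` f @^-1` chart_dom d))
      (chart_fun d \o f \o chart_inv c).

Definition diffeomorphism (R : realType) (M N : manifold R) (f : M -> N) :
    Prop :=
  smooth f /\ exists g : N -> M, [/\ smooth g, cancel f g & cancel g f].

Section product_manifold.
Variable R : realType.

Lemma chart_img_sub_open (T : topologicalType) (n : nat) (c : chart R T n)
    (A : set T) : open A -> open (chart_fun c @` (chart_dom c `&` A)).
Proof.
move=> oA.
have -> : chart_fun c @` (chart_dom c `&` A) =
    (chart_fun c @` chart_dom c) `&` chart_inv c @^-1` A.
  apply/seteqP; split=> [_ [x [cx Ax] <-]|_ [[x cx <-]]] /=.
    by split; [exists x|rewrite /= chart_funK].
  by rewrite chart_funK // => Ax; exists x.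
rewrite openE => y [cy Ay]; apply: filterI.
  by apply: open_nbhs_nbhs; split=> //; exact: chart_img_open.
by apply: (chart_inv_continuous cy); exact: open_nbhs_nbhs.
Qed.

Section prod_chart.
Variables (T1 T2 : topologicalType) (n1 n2 : nat).
Variables (c : chart R T1 n1) (d : chart R T2 n2).

Let dom : set (T1 * T2) := chart_dom c `*` chart_dom d.
Let fn (p : T1 * T2) : 'rV[R]_(n1 + n2) :=
  row_mx (chart_fun c p.1) (chart_fun d p.2).
Let inv (y : 'rV[R]_(n1 + n2)) : T1 * T2 :=
  (chart_inv c (lsubmx y), chart_inv d (rsubmx y)).

Let imgE : fn @` dom = [set y | (chart_fun c @` chart_dom c) (lsubmx y) /\
  (chart_fun d @` chart_dom d) (rsubmx y)].
Proof.
apply/seteqP; split=> [_ [[x y] [/= cx dy] <-]|y [[a ca ya] [b db yb]]].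
  by rewrite /fn row_mxKl row_mxKr; split; [exists x|exists y].
by exists (a, b) => //; rewrite /fn /= ya yb hsubmxK.
Qed.

Let dom_open : open dom.
Proof.
rewrite openE => -[x y] [/= cx dy].
exists (chart_dom c, chart_dom d) => //=; split; apply: open_nbhs_nbhs; split=> //;
  exact: chart_dom_open.
Qed.

Let img_open : open (fn @` dom).
Proof.
rewrite imgE; apply: openI.
  by have /continuousP := @continuous_lsubmx R 1 n1 n2; apply; exact: chart_img_open.
by have /continuousP := @continuous_rsubmx R 1 n1 n2; apply; exact: chart_img_open.
Qed.

Let fnK p : dom p -> inv (fn p) = p.
Proof.
by case: p => x y [/= cx dy]; rewrite /inv /fn row_mxKl row_mxKr !chart_funK.
Qed.

Let fn_continuous p : dom p -> {for p, continuous fn}.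
Proof.
case: p => x y [/= cx dy].
have -> : fn = (fun p => row_mx (chart_fun c p.1) 0 + row_mx 0 (chart_fun d p.2)).
  by apply/funext => p; rewrite add_row_mx addr0 add0r.
apply: (@cvgD _ 'rV[R]_(n1 + n2)).
  apply: (@continuous_comp _ _ _ (fun p : T1 * T2 => chart_fun c p.1) (row_mx^~ 0)).
    apply: (@continuous_comp _ _ _ fst); first exact: cvg_fst.
    exact: chart_fun_continuous.
  exact: continuous_row_mx0.
apply: (@continuous_comp _ _ _ (fun p : T1 * T2 => chart_fun d p.2) (row_mx 0)).
  apply: (@continuous_comp _ _ _ snd); first exact: cvg_snd.
  exact: chart_fun_continuous.
exact: continuous_row_0mx.
Qed.

Let inv_continuous y : (fn @` dom) y -> {for y, continuous inv}.
Proof.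
rewrite imgE => -[yc yd].
have cy : {for y, continuous (chart_inv c \o lsubmx)}.
  exact: (continuous_comp (@continuous_lsubmx R 1 n1 n2 y)
    (chart_inv_continuous yc)).
have dy : {for y, continuous (chart_inv d \o rsubmx)}.
  exact: (continuous_comp (@continuous_rsubmx R 1 n1 n2 y)
    (chart_inv_continuous yd)).
exact: (cvg_pair cy dy).
Qed.

Definition prod_chart : chart R (T1 * T2)%type (n1 + n2) :=
  Chart dom_open img_open fnK fn_continuous inv_continuous.

End prod_chart.

Lemma prod_chart_transition (T1 T2 : topologicalType) (n1 n2 : nat)
    (c c' : chart R T1 n1) (d d' : chart R T2 n2) :
  smooth_transition c c' -> smooth_transition d d' ->
  smooth_transition (prod_chart c d) (prod_chart c' d').
Proof.
move=> cc' dd'; rewrite /smooth_transition.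
have -> : chart_fun (prod_chart c d) @`
      (chart_dom (prod_chart c d) `&` chart_dom (prod_chart c' d')) =
    [set y | (chart_fun c @` (chart_dom c `&` chart_dom c')) (lsubmx y) /\
             (chart_fun d @` (chart_dom d `&` chart_dom d')) (rsubmx y)].
  apply/seteqP; split=> [_ [[x y] [[/= cx dy] [/= cx' dy']] <-]|].
    by rewrite /= row_mxKl row_mxKr; split; [exists x|exists y].
  move=> y [[a [ca ca'] ya] [b [db db'] yb]].
  by exists (a, b) => //=; rewrite ya yb hsubmxK.
have oc := chart_img_sub_open (c := c) (chart_dom_open c').
have od := chart_img_sub_open (c := d) (chart_dom_open d').
exact: smooth_on_row_mx oc od cc' dd'.
Qed.

Lemma hausdorff_prod (T1 T2 : topologicalType) :
  hausdorff_space T1 -> hausdorff_space T2 -> hausdorff_space (T1 * T2)%type.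
Proof.
move=> h1 h2 [x1 x2] [y1 y2] xy; congr pair.
  apply: h1 => A B Ax By.
  have [[p1 p2] [/= [Ap _] [Bp _]]] : (A `*` [set: T2]) `&` (B `*` [set: T2]) !=set0.
    by apply: xy; [exists (A, setT)|exists (B, setT)] => //; split=> //;
      exact: filterT.
  by exists p1.
apply: h2 => A B Ax By.
have [[p1 p2] [/= [_ Ap] [_ Bp]]] : ([set: T1] `*` A) `&` ([set: T1] `*` B) !=set0.
  by apply: xy; [exists (setT, A)|exists (setT, B)] => //; split=> //;
    exact: filterT.
by exists p2.
Qed.

Lemma second_countable_prod (T1 T2 : topologicalType) :
  @second_countable T1 -> @second_countable T2 ->
  @second_countable (T1 * T2)%type.
Proof.
move=> [B1 cB1 [oB1 bB1]] [B2 cB2 [oB2 bB2]].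
exists [set UV.1 `*` UV.2 | UV in B1 `*` B2].
  apply: card_le_trans (card_image_le _ _) _; exact: countableX.
split=> [_ [[U V] [/= BU BV] <-]|[x y] W [[P Q] /= [Px Qy] PQW]].
  rewrite openE => -[x y] [/= Ux Vy].
  by exists (U, V) => //=; split; apply: open_nbhs_nbhs; split=> //;
    [exact: oB1|exact: oB2].
have [U [BU Ux] UP] := bB1 _ _ Px; have [V [BV Vy] VQ] := bB2 _ _ Qy.
exists (U `*` V); first by split=> //; exists (U, V).
by move=> [a b] [/= Ua Vb]; apply: PQW; split; [exact: UP|exact: VQ].
Qed.

Variables M N : manifold R.

Let prod_atlas : set (chart R (M * N)%type (mfd_dim M + mfd_dim N)) :=
  [set prod_chart cd.1 cd.2 | cd in @atlas R M `*` @atlas R N].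

Let prod_atlas_cover p : exists2 c, prod_atlas c & chart_dom c p.
Proof.
have [c Mc cp] := atlas_cover p.1; have [d Nd dp] := atlas_cover p.2.
by exists (prod_chart c d) => //; exists (c, d).
Qed.

Let prod_atlas_smooth c d :
  prod_atlas c -> prod_atlas d -> smooth_transition c d.
Proof.
move=> [[c1 c2] [/= Mc1 Nc2] <-] [[d1 d2] [/= Md1 Nd2] <-].
by apply: prod_chart_transition; exact: atlas_smooth.
Qed.

Definition prod_manifold : manifold R :=
  Manifold (hausdorff_prod (@mfd_hausdorff R M) (@mfd_hausdorff R N))
    (second_countable_prod (@mfd_second_countable R M)
      (@mfd_second_countable R N))
    prod_atlas_cover prod_atlas_smooth.

End product_manifold.

(* [mul] makes the manifold [G] a Lie group with unit [one]. *)
Definition is_lie_group (R : realType) (G : manifold R) (one : G)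
    (mul : G -> G -> G) : Prop :=
  [/\ associative mul, left_id one mul, right_id one mul,
      smooth (fun p : prod_manifold G G => mul p.1 p.2) &
      exists inv : G -> G,
        [/\ smooth inv, left_inverse one inv mul & right_inverse one inv mul]].

Record lie_group (R : realType) := LieGroup {
  lie_mfd :> manifold R;
  lie_one : lie_mfd;
  lie_mul : lie_mfd -> lie_mfd -> lie_mfd;
  lie_groupP : is_lie_group lie_one lie_mul
}.

Definition lie_isomorphic (R : realType) (G K : lie_group R) : Prop :=
  exists f : G -> K, diffeomorphism f /\
    {morph f : a b / lie_mul a b >-> lie_mul a b}.

Record bicocycle_maps (R : realType) (M H : manifold R) (e : M) (u : H) :=
    BicocycleMaps {
  varphi : H -> M -> M;
  psi : H -> M -> H;
  dot : M -> M -> M;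
  theta : M -> M -> H;
  ast : H -> H -> H;
  gamma : H -> H -> M;
  varphi_smooth : smooth (fun p : prod_manifold H M => varphi p.1 p.2);
  psi_smooth : smooth (fun p : prod_manifold H M => psi p.1 p.2);
  dot_smooth : smooth (fun p : prod_manifold M M => dot p.1 p.2);
  theta_smooth : smooth (fun p : prod_manifold M M => theta p.1 p.2);
  ast_smooth : smooth (fun p : prod_manifold H H => ast p.1 p.2);
  gamma_smooth : smooth (fun p : prod_manifold H H => gamma p.1 p.2);
  varphi1 : forall x, varphi u x = x;
  varphie : forall h, varphi h e = e;
  psie : forall h, psi h e = h;
  psi1 : forall x, psi u x = u;
  dotee : dot e e = e;
  ast11 : ast u u = u;
  thetaee : theta e e = u;
  gamma11 : gamma u u = e
}.

Definition bicocycle_mul (R : realType) (M H : manifold R) (e : M) (u : H)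
    (B : bicocycle_maps e u) (p q : prod_manifold M H) : prod_manifold M H :=
  let: (x, h) := p in let: (x', h') := q in
  (dot B x (dot B (varphi B h x') (gamma B (psi B h x') h')),
   ast B (ast B (theta B x (varphi B h x')) (psi B h x')) h').

(* Whether [bicocycle_mul B] is a Lie group structure on [M * H] with unit
   [(e, u)] is a condition on [B]; the double cross product is only defined
   when it is fulfilled. *)
Definition bicocycle_double_cross_product (R : realType) (M H : manifold R)
    (e : M) (u : H) (B : bicocycle_maps e u)
    (BP : @is_lie_group R (prod_manifold M H) (e, u) (bicocycle_mul B)) :
    lie_group R :=
  LieGroup BP.

Definition obtained_by_factorization (R : realType) (M H : manifold R)
    (e : M) (u : H) (G : lie_group R) (i : M -> G) (j : H -> G)
    (B : bicocycle_maps e u) : Prop :=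
  [/\ forall h x, lie_mul (j h) (i x) = lie_mul (i (varphi B h x)) (j (psi B h x)),
      forall x x', lie_mul (i x) (i x') = lie_mul (i (dot B x x')) (j (theta B x x')) &
      forall h h', lie_mul (j h) (j h') = lie_mul (i (gamma B h h')) (j (ast B h h'))].

(* Main.v *)
(* Write [F (x, h) = i x * j h], a diffeomorphism onto [G]. The six maps are the
   components of [F^-1] applied to the products [j h * i x], [i x * i x'] and
   [j h * j h'], so their smoothness reduces to the chain rule.
   The formula for the bicocycle product need not agree a priori with the product
   transported from [G] by [F]. They agree on the products [(x, 1)(x', 1)],
   [(e, h)(e, h')] and [(e, h)(x, 1)], and associativity of the bicocycle product
   forces [gamma (theta x y) k = e] and [theta x (gamma h k) = 1]. With these
   relations the two right multiplications by [(y, 1)], and the two by [(e, k)],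
   coincide, hence so do the two products since [(y, k) = (y, 1)(e, k)]. *)
Require Import Defs.
From HB Require Import structures.
From mathcomp Require Import all_boot all_order all_algebra.
From mathcomp Require Import all_classical all_reals.
From mathcomp Require Import topology normedtype landau derive.

Set Implicit Arguments.
Unset Strict Implicit.
Unset Printing Implicit Defensive.

Import Order.TTheory GRing.Theory Num.Theory.
Import numFieldNormedType.Exports.

Local Open Scope classical_set_scope.
Local Open Scope ring_scope.

(** * The Leibniz rule for a scalar function times a vector-valued one *)

Section scale_functions.
Context {R : realType} {V W : normedModType R}.
Implicit Types (k : V -> R) (g : V -> W).

Let scale_is_bilinear : bilinear_for
    (GRing.Scale.Law.clone _ _ *:%R _) (GRing.Scale.Law.clone _ _ *:%R _)
    (fun (a : R) (w : W) => a *: w).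
Proof.
split=> [w|a] c x y /=; first by rewrite scalerDl scalerA.
by rewrite scalerDr !scalerA mulrC.
Qed.

(** Scaling is packaged as a bilinear map of both arguments, so that [differentiable_bilin] and
    [diff_bilin] yield the product rule. *)
Let scaleB : {bilinear R -> W -> W} :=
  HB.pack (fun (a : R) (w : W) => a *: w)
    (bilinear_isBilinear.Build R R W W _ _ _ scale_is_bilinear).

Let scaleB_continuous : continuous (fun p : R * W => scaleB p.1 p.2).
Proof. exact: scale_continuous. Qed.

Lemma differentiable_scale k g x : differentiable k x -> differentiable g x ->
  differentiable (fun y => k y *: g y) x.
Proof.
move=> dk dg.
apply: (@differentiable_comp _ _ _ _ (fun y => (k y, g y))
  (fun p => scaleB p.1 p.2)); first exact: differentiable_pair.
exact: differentiable_bilin.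
Qed.

Lemma derive_scale k g x v : differentiable k x -> differentiable g x ->
  'D_v (fun y => k y *: g y) x = k x *: 'D_v g x + 'D_v k x *: g x.
Proof.
move=> dk dg; rewrite deriveE; last exact: differentiable_scale.
rewrite (@diff_comp _ _ _ _ (fun y => (k y, g y)) (fun p => scaleB p.1 p.2));
  [|exact: differentiable_pair|exact: differentiable_bilin].
by rewrite diff_bilin //= diff_pair //= !deriveE.
Qed.

End scale_functions.

(** * Iterated differentiability of composites in coordinates *)

Section smooth_on_theory.
Context {R : realType}.

Lemma differentiable_uptoS (m n k : nat) (U : set 'rV[R]_m)
    (f : 'rV[R]_m -> 'rV[R]_n) :
  differentiable_upto k.+1 U f -> differentiable_upto k U f.
Proof.
elim: k f => [//|k IH] f [df Df]; split=> // v; exact: IH (Df v).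
Qed.

(** Each order is a condition at single points on the derivatives ['D_v f], which do not depend on
    the set; so [V] may be any set containing [x]. *)
Lemma differentiable_upto_local (m n k : nat) (U : set 'rV[R]_m)
    (f : 'rV[R]_m -> 'rV[R]_n) :
  (forall x, U x -> exists2 V, V x & differentiable_upto k V f) ->
  differentiable_upto k U f.
Proof.
elim: k f => [//|k IH] f Uf /=; split=> [x Ux|v].
  by have [V Vx [df _]] := Uf x Ux; exact: df.
by apply: IH => x Ux; have [V Vx [_ Df]] := Uf x Ux; exists V => //; exact: Df.
Qed.

Lemma differentiable_upto_cst (m n k : nat) (U : set 'rV[R]_m) (a : 'rV[R]_n) :
  differentiable_upto k U (cst a).
Proof.
elim: k a => [//|k IH] a /=; split=> [x _|v]; first exact: differentiable_cst.
rewrite (_ : (fun x => _) = cst 0); first exact: IH.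
by apply/funext => x; exact: derive_cst.
Qed.

Lemma differentiable_upto_sum (I : Type) (r : seq I) (m n k : nat)
    (U : set 'rV[R]_m) (F : I -> 'rV[R]_m -> 'rV[R]_n) : open U ->
  (forall i, differentiable_upto k U (F i)) ->
  differentiable_upto k U (fun x => \sum_(i <- r) F i x).
Proof.
move=> oU UF; elim: r => [|i r IH].
  rewrite (_ : (fun x => _) = cst 0); first exact: differentiable_upto_cst.
  by apply/funext => x; rewrite big_nil.
rewrite (_ : (fun x => _) = F i + (fun x => \sum_(j <- r) F j x)).
  exact: differentiable_uptoD.
by apply/funext => x; rewrite big_cons.
Qed.

(** Induction by the Leibniz rule: each summand keeps one factor underived, for which one order of
    differentiability is given up. *)
Lemma differentiable_upto_scale (m n p k : nat) (U : set 'rV[R]_m)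
    (f : 'rV[R]_m -> 'rV[R]_p) (g : 'rV[R]_m -> 'rV[R]_n) (j : 'I_p) : open U ->
  differentiable_upto k U f -> differentiable_upto k U g ->
  differentiable_upto k U (fun x => f x 0 j *: g x).
Proof.
move=> oU; elim: k f g => [//|k IH] f g Uf Ug.
have [[df Df] [dg Dg]] := (Uf, Ug).
have dfj x : U x -> differentiable (fun y => f y 0 j) x.
  move=> Ux; apply: (@differentiable_comp _ _ _ _ f (fun N => N 0 j)).
    exact: df.
  exact: differentiable_coord.
split=> [x Ux|v]; first by apply: differentiable_scale; [exact: dfj|exact: dg].
apply: (differentiable_upto_eq oU (f := (fun x => f x 0 j *: 'D_v g x) +
    (fun x => 'D_v f x 0 j *: g x))) => [x Ux|].
  rewrite derive_scale; [|exact: dfj|exact: dg].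
  have fxv : derivable f x v by apply: diff_derivable; exact: df.
  by rewrite !fctE (derive_mx fxv) mxE.
apply: differentiable_uptoD oU (IH _ _ _ (Dg v)) (IH _ _ (Df v) _);
  exact: differentiable_uptoS.
Qed.

(** The chain rule with ['D_v f x] expanded in the canonical basis. The directions of the
    derivatives of [g] become constant, as [differentiable_upto] requires. *)
Lemma derive_comp_row (m n p : nat) (f : 'rV[R]_m -> 'rV[R]_n)
    (g : 'rV[R]_n -> 'rV[R]_p) (x v : 'rV[R]_m) :
  differentiable f x -> differentiable g (f x) ->
  'D_v (g \o f) x =
    \sum_(j < n) 'D_v f x 0 j *: 'D_(delta_mx 0 j : 'rV_n) g (f x).
Proof.
move=> df dg; rewrite deriveE; last exact: differentiable_comp.
rewrite (diff_comp df dg) /= -(deriveE v df) {1}(row_sum_delta ('D_v f x)).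
rewrite linear_sum.
by apply: eq_bigr => j _; rewrite linearZ /= -(deriveE _ dg).
Qed.

Lemma differentiable_upto_comp (m n p k : nat) (U : set 'rV[R]_m)
    (V : set 'rV[R]_n) (f : 'rV[R]_m -> 'rV[R]_n) (g : 'rV[R]_n -> 'rV[R]_p) :
  open U -> (forall x, U x -> V (f x)) ->
  differentiable_upto k U f -> differentiable_upto k V g ->
  differentiable_upto k U (g \o f).
Proof.
move=> oU fUV; elim: k g => [//|k IH] g Uf Vg.
have [[df Df] [dg Dg]] := (Uf, Vg).
split=> [x Ux|v].
  by apply: differentiable_comp; [exact: df|exact: dg (fUV x Ux)].
apply: (differentiable_upto_eq oU (f := fun x => \sum_(j < n)
   'D_v f x 0 j *: ((fun y => 'D_(delta_mx 0 j : 'rV_n) g y) \o f) x)) => [x Ux|].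
  by rewrite derive_comp_row //; [exact: df|exact: dg (fUV x Ux)].
(* The partial derivatives of [g] are again composed with [f], so the induction hypothesis applies
   to them. *)
apply: differentiable_upto_sum => // j; apply: differentiable_upto_scale (Df v) _ => //.
apply: (IH (fun y => _)); [exact: differentiable_uptoS Uf|exact: Dg].
Qed.

End smooth_on_theory.

(** * Smooth maps between manifolds: composition, projections, pairing *)

Section smooth_theory.
Context {R : realType}.
Implicit Types M N P : manifold R.

Lemma smooth_comp M N P (f : M -> N) (g : N -> P) :
  smooth f -> smooth g -> smooth (g \o f).
Proof.
move=> [fC fS] [gC gS].
have gfC : continuous (g \o f).
  by move=> x; apply: continuous_comp; [exact: fC|exact: gC].
split=> // c e Mc Pe k.
apply: differentiable_upto_local => _ [x [cx ex] <-].
have [d Nd dx] := atlas_cover (f x).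
(* On [A] a chart [d] around [f x] can be inserted between [f] and [g], which factors the local
   expression of [g \o f]. *)
pose A := f @^-1` chart_dom d `&` (g \o f) @^-1` chart_dom e.
have oA : open A.
  by apply: openI; [move/continuousP: fC|move/continuousP: gfC]; apply;
    exact: chart_dom_open.
exists (chart_fun c @` (chart_dom c `&` A)); first by exists x.
pose fcd := chart_fun d \o f \o chart_inv c.
pose gde := chart_fun e \o g \o chart_inv d.
apply: (differentiable_upto_eq (chart_img_sub_open oA) (f := gde \o fcd)).
  by move=> _ [z [cz [dz ez]] <-]; rewrite /gde /fcd /= !chart_funK.
apply: (differentiable_upto_comp (chart_img_sub_open oA)
  (V := chart_fun d @` (chart_dom d `&` g @^-1` chart_dom e))).
- move=> _ [z [cz [dz ez]] <-]; exists (f z) => //.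
  by rewrite /fcd /= chart_funK.
- apply: (differentiable_upto_sub _ (fS c d Mc Nd k)) => _ [z [cz [dz _]] <-].
  by exists z.
- exact: gS.
Qed.

(** In charts the projection is [lsubmx] followed by a transition map of [M]. *)
Lemma smooth_fst M N : smooth (fst : prod_manifold M N -> M).
Proof.
split=> [x|_ d [[c1 c2] [/= Mc Nc] <-] Md k]; first exact: cvg_fst.
have oU := chart_img_sub_open (c := c1) (chart_dom_open d).
have lC := @continuous_lsubmx R 1 (mfd_dim M) (mfd_dim N).
have := differentiable_upto_linear (l := lsubmx) (L := idfun) lC _ oU
  (atlas_smooth Mc Md k).
move=> /(_ (fun x => cvg_id)); apply: differentiable_upto_sub.
by move=> _ [[x y] [[/= cx cy] dx] <-]; rewrite /= row_mxKl; exists x.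
Qed.

Lemma smooth_snd M N : smooth (snd : prod_manifold M N -> N).
Proof.
split=> [x|_ d [[c1 c2] [/= Mc Nc] <-] Nd k]; first exact: cvg_snd.
have oU := chart_img_sub_open (c := c2) (chart_dom_open d).
have rC := @continuous_rsubmx R 1 (mfd_dim M) (mfd_dim N).
have := differentiable_upto_linear (l := rsubmx) (L := idfun) rC _ oU
  (atlas_smooth Nc Nd k).
move=> /(_ (fun x => cvg_id)); apply: differentiable_upto_sub.
by move=> _ [[x y] [[/= cx cy] dx] <-]; rewrite /= row_mxKr; exists y.
Qed.

Lemma smooth_pair P M N (f : P -> M) (g : P -> N) : smooth f -> smooth g ->
  smooth (fun x => (f x, g x) : prod_manifold M N).
Proof.
move=> [fC fS] [gC gS].
split=> [x|c _ Pc [[d1 d2] [/= Md Nd] <-] k].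
  by apply: cvg_pair; [exact: fC|exact: gC].
pose n := mfd_dim P.
(* The pairing is the product map of [f] and [g] after the linear diagonal [x |-> (x, x)], so
   [smooth_on_row_mx] applies. *)
pose diag := mulmxr (row_mx 1%:M 1%:M : 'M[R]_(n, n + n)) : 'rV_n -> _.
have diagE : diag = (fun x => row_mx x 0) + row_mx 0.
  apply/funext => x.
  by rewrite !fctE /diag /= mul_mx_row !mulmx1 add_row_mx addr0 add0r.
have diagC : continuous diag.
  rewrite diagE => x; apply: (@cvgD _ 'rV[R]_(n + n)).
    exact: (@nbhs_filter 'rV[R]_n).
    exact: (@continuous_row_mx0 R n n x).
  exact: (@continuous_row_0mx R n n x).
pose U := chart_fun c @` (chart_dom c `&` f @^-1` chart_dom d1).
pose V := chart_fun c @` (chart_dom c `&` g @^-1` chart_dom d2).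
have oU : open U.
  by apply: chart_img_sub_open; move/continuousP: fC; apply; exact: chart_dom_open.
have oV : open V.
  by apply: chart_img_sub_open; move/continuousP: gC; apply; exact: chart_dom_open.
have oW : open [set y : 'rV[R]_(n + n) | U (lsubmx y) /\ V (rsubmx y)].
  apply: openI.
    by have /continuousP := @continuous_lsubmx R 1 n n; apply.
  by have /continuousP := @continuous_rsubmx R 1 n n; apply.
have := differentiable_upto_linear (l := diag) (L := idfun) diagC
  (fun x => cvg_id) oW (smooth_on_row_mx oU oV (fS c d1 Pc Md) (gS c d2 Pc Nd) k).
have diagl x : lsubmx (diag x) = x.
  by rewrite diagE !fctE add_row_mx addr0 add0r row_mxKl.
have diagr x : rsubmx (diag x) = x.
  by rewrite diagE !fctE add_row_mx addr0 add0r row_mxKr.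
rewrite (_ : (fun x => _) = (fun x => row_mx
  ((chart_fun d1 \o f \o chart_inv c) x) ((chart_fun d2 \o g \o chart_inv c) x))).
  apply: differentiable_upto_sub => _ [x [cx [/= d1x d2x]] <-] /=.
  by rewrite diagl diagr; split; exists x.
by apply/funext => x /=; rewrite diagl diagr.
Qed.

End smooth_theory.

(** * Unique factorization in [G] and the six maps it defines *)

Section factorization.
Context {R : realType} {M H : manifold R} {e : M} {u : H} {G : lie_group R}.
Context {i : M -> G} {j : H -> G}.
Hypotheses (i_e : i e = lie_one G) (j_u : j u = lie_one G).

Let F (p : prod_manifold M H) : G := lie_mul (i p.1) (j p.2).

Let mulA : associative (@lie_mul R G).
Proof. by have [] := lie_groupP G. Qed.

Let mul1g : left_id (lie_one G) (@lie_mul R G).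
Proof. by have [] := lie_groupP G. Qed.

Let mulg1 : right_id (lie_one G) (@lie_mul R G).
Proof. by have [] := lie_groupP G. Qed.

Let mulgI (a : G) : injective (lie_mul a).
Proof.
have [_ _ _ _ [inv [_ invl _]]] := lie_groupP G.
by move=> b c /(congr1 (lie_mul (inv a))); rewrite !mulA invl !mul1g.
Qed.

Let mulIg (a : G) : injective (fun b : G => lie_mul b a).
Proof.
have [_ _ _ _ [inv [_ _ invr]]] := lie_groupP G.
by move=> b c /(congr1 (fun d : G => lie_mul d (inv a))); rewrite -!mulA invr !mulg1.
Qed.

Let F1 x : F (x, u) = i x.
Proof. by rewrite /F /= j_u mulg1. Qed.

Let F2 h : F (e, h) = j h.
Proof. by rewrite /F /= i_e mul1g. Qed.

Lemma factorization_bicocycle_maps : smooth i -> smooth j ->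
  diffeomorphism F ->
  exists B : bicocycle_maps e u, obtained_by_factorization i j B.
Proof.
move=> i_smooth j_smooth [_ [g [gS FK gK]]].
have [_ _ _ mulS _] := lie_groupP G.
have prodS (P Q : manifold R) (a : P -> G) (b : Q -> G) : smooth a -> smooth b ->
    smooth (fun p : prod_manifold P Q => g (lie_mul (a p.1) (b p.2))).
  move=> aS bS; have abS := smooth_pair (smooth_comp (@smooth_fst _ P Q) aS)
    (smooth_comp (@smooth_snd _ P Q) bS).
  exact: smooth_comp (smooth_comp abS mulS) gS.
have prodS1 P Q a b aS bS := smooth_comp (@prodS P Q a b aS bS) (@smooth_fst _ M H).
have prodS2 P Q a b aS bS := smooth_comp (@prodS P Q a b aS bS) (@smooth_snd _ M H).
(* The normalization conditions are the components of the trivial factorizations [i x = F (x, u)]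
   and [j h = F (e, h)]. *)
have g1i x : g (lie_mul (j u) (i x)) = (x, u) by rewrite j_u mul1g -F1 FK.
have gj1 h : g (lie_mul (j h) (i e)) = (e, h) by rewrite i_e mulg1 -F2 FK.
have gii : g (lie_mul (i e) (i e)) = (e, u) by rewrite {1}i_e mul1g -F1 FK.
have gjj : g (lie_mul (j u) (j u)) = (e, u) by rewrite {1}j_u mul1g -F2 FK.
exists (BicocycleMaps
  (varphi := fun h x => (g (lie_mul (j h) (i x))).1)
  (psi := fun h x => (g (lie_mul (j h) (i x))).2)
  (dot := fun x y => (g (lie_mul (i x) (i y))).1)
  (theta := fun x y => (g (lie_mul (i x) (i y))).2)
  (ast := fun h k => (g (lie_mul (j h) (j k))).2)
  (gamma := fun h k => (g (lie_mul (j h) (j k))).1)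
  (prodS1 _ _ _ _ j_smooth i_smooth) (prodS2 _ _ _ _ j_smooth i_smooth)
  (prodS1 _ _ _ _ i_smooth i_smooth) (prodS2 _ _ _ _ i_smooth i_smooth)
  (prodS2 _ _ _ _ j_smooth j_smooth) (prodS1 _ _ _ _ j_smooth j_smooth)
  (fun x => congr1 fst (g1i x)) (fun h => congr1 fst (gj1 h))
  (fun h => congr1 snd (gj1 h)) (fun x => congr1 snd (g1i x))
  (congr1 fst gii) (congr1 snd gjj) (congr1 snd gii) (congr1 fst gjj)).
(* Writing a product as [F] of its image under [g] displays the two factors. *)
by split=> a b /=; rewrite -[LHS]gK.
Qed.

(** * Comparison of the bicocycle product with the product of [G] *)

Variable B : bicocycle_maps e u.
Hypotheses (F_inj : injective F) (ijB : obtained_by_factorization i j B).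

Let jiE h x : lie_mul (j h) (i x) = lie_mul (i (varphi B h x)) (j (psi B h x)).
Proof. by case: ijB. Qed.

Let iiE x y : lie_mul (i x) (i y) = lie_mul (i (dot B x y)) (j (theta B x y)).
Proof. by case: ijB. Qed.

Let jjE h k : lie_mul (j h) (j k) = lie_mul (i (gamma B h k)) (j (ast B h k)).
Proof. by case: ijB. Qed.

(** Unit laws beyond the fields of [bicocycle_maps], here and in the next three facts, come from
    injectivity of [F]. *)
Let dot_theta_x1 x : dot B x e = x /\ theta B x e = u.
Proof.
by have := iiE x e; rewrite i_e mulg1 -F1 => /(F_inj (x2 := (_, _)))[<- <-].
Qed.

Let dot_theta_1x x : dot B e x = x /\ theta B e x = u.
Proof.
by have := iiE e x; rewrite i_e mul1g -F1 => /(F_inj (x2 := (_, _)))[<- <-].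
Qed.

Let gamma_ast_h1 h : gamma B h u = e /\ ast B h u = h.
Proof.
by have := jjE h u; rewrite j_u mulg1 -F2 => /(F_inj (x2 := (_, _)))[<- <-].
Qed.

Let gamma_ast_1h h : gamma B u h = e /\ ast B u h = h.
Proof.
by have := jjE u h; rewrite j_u mul1g -F2 => /(F_inj (x2 := (_, _)))[<- <-].
Qed.

Let dotx1 x : dot B x e = x. Proof. by case: (dot_theta_x1 x). Qed.
Let thetax1 x : theta B x e = u. Proof. by case: (dot_theta_x1 x). Qed.
Let dot1x x : dot B e x = x. Proof. by case: (dot_theta_1x x). Qed.
Let theta1x x : theta B e x = u. Proof. by case: (dot_theta_1x x). Qed.
Let gammah1 h : gamma B h u = e. Proof. by case: (gamma_ast_h1 h). Qed.
Let asth1 h : ast B h u = h. Proof. by case: (gamma_ast_h1 h). Qed.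
Let gamma1h h : gamma B u h = e. Proof. by case: (gamma_ast_1h h). Qed.
Let ast1h h : ast B u h = h. Proof. by case: (gamma_ast_1h h). Qed.

Let unitE := (dotx1, dot1x, thetax1, theta1x, gammah1, gamma1h, asth1, ast1h,
  varphi1 B, varphie B, psi1 B, psie B).

Let bicocycle_mulx1 x h y : bicocycle_mul B (x, h) (y, u) =
  (dot B x (varphi B h y), ast B (theta B x (varphi B h y)) (psi B h y)).
Proof. by rewrite /= !unitE. Qed.

Let bicocycle_mul1h x h k : bicocycle_mul B (x, h) (e, k) =
  (dot B x (gamma B h k), ast B h k).
Proof. by rewrite /= !unitE. Qed.

Let bicocycle_mul1x x y h : bicocycle_mul B (x, u) (y, h) =
  (dot B x y, ast B (theta B x y) h).
Proof. by rewrite /= !unitE. Qed.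

Hypothesis mulBA : associative (bicocycle_mul B).

(** Associativity on [(x, u)], [(y, u)], [(e, k)] gives [dot B x y = dot B (dot B x y) c] in the
    first component. Cancelling in [G] puts [i c] in the image of [j], which meets that of [i] only
    in the unit. *)
Lemma gamma_theta x y k : gamma B (theta B x y) k = e.
Proof.
set c := gamma B _ _.
have := mulBA (x, u) (y, u) (e, k).
rewrite !bicocycle_mul1x bicocycle_mul1h !unitE => -[ac].
have := iiE (dot B x y) c; rewrite -ac => /mulgI; rewrite -F1 -F2.
by move=> /F_inj[].
Qed.

Let jthetaj x y k : lie_mul (j (theta B x y)) (j k) = j (ast B (theta B x y) k).
Proof. by rewrite jjE gamma_theta i_e mul1g. Qed.

(** Associativity on [(x, u)], [(e, h)], [(e, k)] shows in the second component that
    [theta B x (gamma B h k)] fixes [ast B h k] from the left. By [jthetaj] this is an equation in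
    [G], where [j (ast B h k)] cancels. *)
Lemma theta_gamma x h k : theta B x (gamma B h k) = u.
Proof.
have := mulBA (x, u) (e, h) (e, k).
rewrite !bicocycle_mul1h !bicocycle_mul1x !unitE.
move=> [] /(congr1 j); rewrite -jthetaj -[RHS]mul1g => /mulIg.
by rewrite -i_e -[LHS]F2 -F1 => /F_inj[].
Qed.

Lemma factorization_morph : {morph F : p q / bicocycle_mul B p q >-> lie_mul p q}.
Proof.
have Fx x h y : F (bicocycle_mul B (x, h) (y, u)) = lie_mul (F (x, h)) (i y).
  by rewrite bicocycle_mulx1 /F /= -jthetaj mulA -iiE -!mulA jiE.
have Fh x h k : F (bicocycle_mul B (x, h) (e, k)) = lie_mul (F (x, h)) (j k).
  by rewrite bicocycle_mul1h /F /= -!mulA jjE mulA iiE theta_gamma j_u mulg1.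
move=> [x h] [y k].
have yk : (y, k) = bicocycle_mul B (y, u) (e, k).
  by rewrite bicocycle_mul1h !unitE.
(* [bicocycle_mulx1] exposes the left factor as the explicit pair that [Fh] expects, and is then
   folded back for [Fx]. *)
by rewrite [in LHS]yk mulBA bicocycle_mulx1 Fh -bicocycle_mulx1 Fx -mulA.
Qed.

End factorization.

Theorem proposition2p4 (R : realType) (M H : manifold R) (e : M) (u : H)
    (G : lie_group R) (i : M -> G) (j : H -> G)
    (i_smooth : smooth i) (j_smooth : smooth j)
    (i_inj : injective i) (j_inj : injective j)
    (i_e : i e = lie_one G) (j_u : j u = lie_one G)
    (ij_diffeo : diffeomorphism
       (fun p : prod_manifold M H => lie_mul (i p.1) (j p.2))) :
  (exists B : bicocycle_maps e u, obtained_by_factorization i j B) /\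
  (forall B : bicocycle_maps e u, obtained_by_factorization i j B ->
   forall BP : @is_lie_group R (prod_manifold M H) (e, u) (bicocycle_mul B),
   lie_isomorphic G (bicocycle_double_cross_product BP)).
Proof.
split; first exact: factorization_bicocycle_maps.
move=> B ijB BP; have [mulBA _ _ _ _] := BP.
have [FS [g [gS FK gK]]] := ij_diffeo.
have F_morph := factorization_morph i_e j_u (can_inj FK) ijB mulBA.
(* The isomorphism starts from [G], so it is the inverse [g]; its multiplicativity is tested after
   applying the injective [F]. *)
exists g; split=> [|a b].
  by split=> //; exists (fun p => lie_mul (i p.1) (j p.2)).
by apply: (can_inj FK); rewrite F_morph !gK.
Qed.
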